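(* Let $n$ be a positive integer and let $\mathcal{V}(Z(n))=B_1\times\cdots\times B_s$ be the associated multivector of its Zeckendorf 2-partition. Then \[F(n;t)=D(B_1;t)\,D(B_2;t)\cdots D(B_s;t).\]
   Context: Let $f_0=f_1=1$ and $f_i=f_{i-1}+f_{i-2}$ for $i\ge 2$ (so $f_1=1,f_2=2,f_3=3,f_4=5,\dots$). A Fibonacci partition of $n\in\mathbb{N}=\{0,1,2,\dots\}$ is a finite set $\{f_{i_1},\dots,f_{i_h}\}$ with $1\le i_1<\dots<i_h$ and $f_{i_1}+\dots+f_{i_h}=n$; $h$ is its number of parts. $F_h(n)$ denotes the number of Fibonacci partitions of $n$ with $h$ parts, and $F(n;t)=\sum_{h\ge 0}F_h(n)t^h$ (with $F_0(0)=1$ and $F_0(n)=0$ for $n>0$). For an integer $m$, $\lambda(m)\in\{0,1\}$ is $m\bmod 2$. A 2-partition is a finite set of integers $I=\{i_1<\dots<i_q\}$ with $i_1\ge 1$ and $i_{a+1}-i_a\ge 2$ for all $a$. By Zeckendorf's theorem each $n\in\mathbb{N}$ has a unique representation $n=f_{\mu_1(n)}+\dots+f_{\mu_q(n)}$ with $Z(n)=\{\mu_1(n)<\dots<\mu_q(n)\}$ a 2-partition. A 2-partition is simple if all its elements have the same parity. The canonical form of a nonempty 2-partition $I$ is the unique decomposition $I=I_1\cup\dots\cup I_s$ into simple 2-partitions with $\max I_a<\min I_{a+1}$ and $\min(I_{a+1})-\max(I_a)$ odd for $a=1,\dots,s-1$ (i.e. $I$ is cut into maximal runs of consecutive elements of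 equal parity). The associated vector of $I=\{i_1<\dots<i_q\}$ is $(\alpha_1,\dots,\alpha_q)$ with $\alpha_1=\lfloor (i_1-1)/2\rfloor+1$ and $\alpha_r=\lfloor (i_r-i_{r-1})/2\rfloor+1$ for $r>1$. Writing $d_0=0$, $d_m=|I_1|+\dots+|I_m|$, let $B_m=(\alpha_{d_{m-1}+1},\dots,\alpha_{d_m})$; the associated multivector is $\mathcal{V}(I)=B_1\times\cdots\times B_s$. For $\alpha\in\mathbb{N}$ let $\phi_\alpha(t)=t+t^2+\dots+t^\alpha$. For an integer vector $(\alpha_1,\dots,\alpha_r)$ the polynomial $D(\alpha_1,\dots,\alpha_r;t)$ is defined by $D(\emptyset;t)=1$, $D(\alpha_1;t)=\phi_{\alpha_1}(t)$ and for $r\ge 2$ \[D(\alpha_1,\dots,\alpha_r;t)=\phi_{\alpha_r}(t)D(\alpha_1,\dots,\alpha_{r-1};t)-t^{\alpha_r+1}D(\alpha_1,\dots,\alpha_{r-2};t).\] *)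

(* Defs.v *)
From mathcomp Require Import all_boot all_order all_algebra.

Set Implicit Arguments.
Unset Strict Implicit.
Unset Printing Implicit Defensive.

Import GRing.Theory.

Fixpoint fib (n : nat) : nat :=
  match n with
  | 0 => 1
  | n1.+1 => match n1 with
             | 0 => 1
             | n2.+1 => fib n1 + fib n2
             end
  end.

Arguments fib : simpl never.

Lemma fibSS n : fib n.+2 = fib n.+1 + fib n. Proof. by []. Qed.

Lemma fib_gt0 n : 0 < fib n.
Proof.
suff /andP[] : (0 < fib n) && (0 < fib n.+1) by [].
by elim: n => [|n /andP[h1 h2]] //; rewrite h2 fibSS addn_gt0 h2.
Qed.

Lemma leq_fib n : n <= fib n.
Proof.
suff /andP[] : (n <= fib n) && (n.+1 <= fib n.+1) by [].
elim: n => [|n /andP[h1 h2]] //; rewrite h2 fibSS /=.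
by rewrite -addn1 leq_add // fib_gt0.
Qed.

(** A Fibonacci partition is a set of numbers [fib i] with [1 <= i]. The parts
    live in ['I_n.+1] because each part is at most the sum [n]; the index [i]
    may be bounded by [n] as well, since [i <= fib i] (lemma [leq_fib]). *)
Definition fib_partitions (n : nat) : {set {set 'I_n.+1}} :=
  [set P : {set 'I_n.+1} |
    [forall x in P, [exists i : 'I_n.+1, (0 < i) && (fib i == x)]]
    && (\sum_(x in P) (x : nat) == n)].

Definition fib_count (h n : nat) : nat :=
  #|[set P in fib_partitions n | #|P| == h]|.

(** The generating polynomial; a partition of [n] has at most [n] parts, so the
    truncation loses nothing (lemma [coef_fib_gf]). *)
Definition fib_gf (n : nat) : {poly int} :=
  (\poly_(h < n.+1) (fib_count h n)%:R)%R.

Lemma fib_count_eq0 h n : n < h -> fib_count h n = 0.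
Proof.
move=> lt_nh; apply/eqP; rewrite cards_eq0; apply/eqP/setP => P.
rewrite !inE; apply/negP => /andP[/andP[/forall_inP Pfib /eqP sumP] /eqP cardP].
suff: #|P| <= \sum_(x in P) (x : nat) by rewrite sumP cardP leqNgt lt_nh.
rewrite -sum1_card; apply: leq_sum => x /Pfib /existsP[i /andP[_ /eqP <-]]; exact: fib_gt0.
Qed.

Lemma coef_fib_gf h n : ((fib_gf n)`_h = (fib_count h n)%:R)%R.
Proof.
by rewrite coef_poly; case: ltnP => // /fib_count_eq0 ->.
Qed.

(** Finite sets of integers are represented by increasing sequences. *)
Definition two_partition (I : seq nat) : bool :=
  all (leq 1) I && sorted (fun i j => i.+2 <= j) I.

Definition zeckendorf_of (n : nat) (I : seq nat) : bool :=
  two_partition I && (\sum_(i <- I) fib i == n).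

Lemma two_partition_rcons I i :
  two_partition (rcons I i)
  = [&& 0 < i, all (fun j => j.+2 <= i) I & two_partition I].
Proof.
have tr : transitive (fun i j : nat => i.+2 <= j).
  by move=> b a c ab bc; apply: leq_trans ab (leq_trans _ bc); rewrite ltnW.
rewrite /two_partition !sorted_pairwise // pairwise_rcons all_rcons -!andbA.
by congr andb; rewrite andbCA.
Qed.

Lemma zeckendorf_bounded k n : n < fib k.+1 ->
  exists2 I, all (fun j => j <= k) I & zeckendorf_of n I.
Proof.
elim/ltn_ind: k n => -[|[|k]] IH n lt_n.
- by exists [::] => //; rewrite /zeckendorf_of big_nil; case: n lt_n.
- case: n lt_n => [|[|n]] // _.
    by exists [::] => //; rewrite /zeckendorf_of big_nil.
  by exists [:: 1] => //; rewrite /zeckendorf_of big_seq1.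
- have [lt2|le2] := ltnP n (fib k.+2).
    have [I Ik ZI] := IH k.+1 (ltnSn _) _ lt2.
    by exists I => //; apply: sub_all Ik => j /leqW.
  have lt1 : n - fib k.+2 < fib k.+1.
    by rewrite ltn_subLR // addnC addnC -fibSS.
  have [I Ik /andP[I2 /eqP sI]] := IH k (leqnSn _) _ lt1.
  exists (rcons I k.+2).
    by rewrite all_rcons leqnn /=; apply: sub_all Ik => j /leqW/leqW.
  rewrite /zeckendorf_of two_partition_rcons I2 andbT /=.
  by rewrite (sub_all _ Ik) // -cats1 big_cat big_seq1 /= sI subnK.
Qed.

Lemma zeckendorf_exists n : exists I, zeckendorf_of n I.
Proof.
have [|I _ ZI] := @zeckendorf_bounded n n; last by exists I.
exact: leq_fib n.+1.
Qed.

(** [Z(n)]: the representation given by Zeckendorf's theorem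
    (see [zeckendorfP] and [zeckendorf_unique]). *)
Definition zeckendorf (n : nat) : seq nat := xchoose (zeckendorf_exists n).

Lemma zeckendorfP n : zeckendorf_of n (zeckendorf n).
Proof. exact: xchooseP. Qed.

Lemma two_partition_sum_lt k I : two_partition I ->
  all (fun j => j <= k) I -> \sum_(i <- I) fib i < fib k.+1.
Proof.
elim/ltn_ind: k I => k IH I; case/lastP: I => [|I i].
  by rewrite big_nil fib_gt0.
rewrite two_partition_rcons all_rcons => /and3P[i0 Ii I2] /andP[ik Ik].
rewrite -cats1 big_cat big_seq1 /=.
case: k i i0 ik Ii IH Ik => [|k] [|i] // _ ik Ii IH Ik.
have [lt_ik|le_ki] := ltnP i k.
  have := IH k (ltnSn k) (rcons I i.+1).
  rewrite two_partition_rcons I2 Ii /= all_rcons lt_ik -cats1 big_cat big_seq1 /=.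
  move=> H; apply: leq_trans (leq_addr _ _); apply: H => //.
  by apply: sub_all Ii => j; rewrite ltnS => ji; exact: ltnW (ltn_trans ji lt_ik).
have -> : i = k by apply/eqP; rewrite eqn_leq le_ki -ltnS ik.
rewrite fibSS addnC ltn_add2l.
have {le_ki}eik : i = k by apply/eqP; rewrite eqn_leq le_ki -ltnS ik.
case: k IH Ik ik eik => [|k] IH _ _ eik; subst i.
  by case: I Ii {I2} => [|j I] //; rewrite big_nil.
by apply: IH => //; rewrite ltnW.
Qed.

Lemma zeckendorf_unique n I : zeckendorf_of n I -> I = zeckendorf n.
Proof.
suff uniqZ J1 J2 : two_partition J1 -> two_partition J2 ->
    \sum_(i <- J1) fib i = \sum_(i <- J2) fib i -> J1 = J2.
  move=> /andP[I2 /eqP sI]; have /andP[Z2 /eqP sZ] := zeckendorfP n.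
  by apply: uniqZ; rewrite ?sI ?sZ.
have le_top K1 i K2 j : two_partition (rcons K1 i) ->
    two_partition (rcons K2 j) -> \sum_(a <- rcons K1 i) fib a =
    \sum_(a <- rcons K2 j) fib a -> j <= i.
  rewrite [two_partition (rcons K2 j)]two_partition_rcons => P1 /and3P[j0 _ _].
  move=> eqs; rewrite leqNgt; apply/negP => lt_ij.
  case: j j0 lt_ij eqs => // j _ lt_ij eqs.
  have := @two_partition_sum_lt j _ P1; rewrite eqs all_rcons -cats1 big_cat big_seq1 /=.
  rewrite ltnS in lt_ij; rewrite lt_ij ltnNge leq_addl => H.
  suff /H : all (fun a => a <= j) K1 by [].
  move: P1; rewrite two_partition_rcons => /and3P[_ K1i _].
  apply: sub_all K1i => a ai; apply: leq_trans (ltnW (ltnW ai)) _.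
  exact: lt_ij.
elim/last_ind: J1 J2 => [|J1 i IH] J2; case/lastP: J2 => [|J2 j] //.
- by move=> _ _ /eqP; rewrite big_nil -cats1 big_cat big_seq1 /= eq_sym
    addn_eq0 [fib j == 0]eqn0Ngt fib_gt0 andbF.
- by move=> _ _ /eqP; rewrite big_nil -cats1 big_cat big_seq1 /=
    addn_eq0 [fib i == 0]eqn0Ngt fib_gt0 andbF.
move=> P1 P2 eqs.
have eij : i = j.
  by apply/eqP; rewrite eqn_leq (le_top _ _ _ _ P1 P2 eqs)
    (le_top _ _ _ _ P2 P1 (esym eqs)).
move: P1 P2 eqs; rewrite eij !two_partition_rcons -!cats1 !big_cat !big_seq1 /=.
move=> /and3P[_ _ P1] /and3P[_ _ P2] /eqP; rewrite eqn_add2r => /eqP eqs.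
by rewrite (IH _ P1 P2 eqs).
Qed.

Definition same_parity (I : seq nat) : bool :=
  all (fun i => all (fun j => odd i == odd j) I) I.

Definition simple (I : seq nat) : bool := two_partition I && same_parity I.

Definition is_canonical_form (I : seq nat) (Is : seq (seq nat)) : Prop :=
  [/\ flatten Is = I,
      all (fun J => J != [::]) Is,
      all simple Is
    & sorted (fun J K => (last 0 J < head 0 K) && odd (head 0 K - last 0 J)) Is].

(** Cuts [I] into maximal runs of consecutive elements of equal parity; this is
    the unique canonical form (lemmas [canonical_formP], [canonical_form_unique]). *)
Fixpoint canonical_form (I : seq nat) : seq (seq nat) :=
  if I is i :: I' then
    match canonical_form I' with
    | (j :: J) :: Js => if odd i == odd j then (i :: j :: J) :: Js
                        else [:: i] :: (j :: J) :: Js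
    | _ => [:: [:: i]]
    end
  else [::].

Lemma canonical_form_runs Is :
  all (fun J => J != [::]) Is -> all same_parity Is ->
  sorted (fun J K => odd (last 0 J) != odd (head 0 K)) Is ->
  canonical_form (flatten Is) = Is.
Proof.
elim: Is => [|J Is IH] //= /andP[J0 Is0] /andP[Jp Isp] Iss.
have {}IH := IH Is0 Isp (path_sorted Iss).
elim: J J0 Jp Iss => [|i [|j J] IHJ] //= _.
  move=> _; rewrite IH; case: Is {IH IHJ} Is0 Isp => [|[|k K] Is] //= _ _.
  by move=> /andP[/negbTE ->].
move=> Jp Iss; rewrite /= in IHJ.
rewrite IHJ //; last by case: {Is0 Isp IH IHJ} Is Iss.
  by move: Jp => /andP[/and3P[_ -> _] _].
apply/allP => a aJ; apply/allP => b bJ.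
have /allP /(_ a) := Jp; rewrite inE aJ orbT => /(_ isT).
by move/allP/(_ b); rewrite inE bJ orbT => /(_ isT).
Qed.

Lemma canonical_form_unique I Is :
  is_canonical_form I Is -> Is = canonical_form I.
Proof.
case=> <- Is0 Iss IsS; rewrite canonical_form_runs //.
  by apply: sub_all Iss => J /andP[].
apply: sub_sorted IsS => J K /andP[lt_JK]; rewrite oddB; last exact: ltnW.
by case: odd; case: odd.
Qed.

Lemma canonical_formP I :
  two_partition I -> is_canonical_form I (canonical_form I).
Proof.
elim: I => [|i I IH] // /andP[/= /andP[i0 I0] Is].
have {IH}[fI Ine Isim Isep] : is_canonical_form I (canonical_form I).
  by apply: IH; rewrite /two_partition I0 (path_sorted Is).
have i1 : simple [:: i] by rewrite /simple /two_partition /same_parity /= i0 eqxx.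
case: (canonical_form I) fI Ine Isim Isep => [|[|j J] Js] //=.
  by move=> <- _ _ _; split; rewrite //= i1.
move=> eI; rewrite -{}eI /= in I0 Is *; move: Is => /andP[ij _].
move=> Jne /andP[Jsim Jssim] Jsep; case: eqP => [eij|/eqP nij]; split => //=.
- apply/andP; split=> //; move: Jsim => /andP[/andP[Jpos Jst] Jpar].
  rewrite /simple /two_partition /= i0 ij -[_ && all _ J]/(all (leq 1) (j :: J)).
  rewrite Jpos (Jst : path _ j J) /=.
  have iJ a : a \in j :: J -> odd i == odd a.
    by move=> aJ; rewrite eij; move/allP: Jpar => /(_ j (mem_head _ _)) /allP ->.
  apply/allP => a; rewrite inE => aiJ; apply/allP => b; rewrite inE => biJ.
  have -> : odd a = odd i by case/predU1P: aiJ => [->|/iJ /eqP].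
  by case/predU1P: biJ => [->|/iJ].
- by case: {I0 Jne Jssim} Js Jsep.
- by rewrite i1 Jsim.
- by rewrite Jsep (ltnW ij) /= oddB ?(ltnW (ltnW ij)) // andbT addbC -negb_eqb.
Qed.

Definition assoc_vector (I : seq nat) : seq nat :=
  if I is i :: I' then
    (i - 1)./2.+1 :: pairmap (fun a b => (b - a)./2.+1) i I'
  else [::].

Definition multivector (I : seq nat) : seq (seq nat) :=
  reshape (shape (canonical_form I)) (assoc_vector I).

Local Open Scope ring_scope.

Definition phi (a : nat) : {poly int} := \sum_(1 <= i < a.+1) 'X^i.

(** The recurrence for [D] removes entries from the right end, hence the
    recursion on the reversed vector (see [D_nil], [D_seq1], [D_rcons2]). *)
Fixpoint Drev (s : seq nat) : {poly int} :=
  match s with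
  | [::] => 1
  | a :: s1 => match s1 with
               | [::] => phi a
               | b :: s2 => phi a * Drev s1 - 'X^(a.+1) * Drev s2
               end
  end.

Definition D (s : seq nat) : {poly int} := Drev (rev s).

Lemma D_nil : D [::] = 1. Proof. by []. Qed.

Lemma D_seq1 a : D [:: a] = phi a. Proof. by []. Qed.

Lemma D_rcons2 s b a :
  D (rcons (rcons s b) a) = phi a * D (rcons s b) - 'X^(a.+1) * D s.
Proof. by rewrite /D !rev_rcons. Qed.

(* Main.v *)
(** Put [P k = \prod_(1 <= i <= k) (1 + t y^(fib i))], so that [F(n; t)] is the
    coefficient of [y^n] in [P k] for large [k]. Let [i] be the largest
    Zeckendorf index of [n = fib i + m]. A partition of [n] either uses [fib i],
    which leaves [m], or it must use [fib i.-1], which leaves [fib i.-2 + m] to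
    be written with parts below [fib i.-1]. Iterating this descends from [i] in
    steps of two towards the next Zeckendorf index [j]. If [i - j] is odd the
    descent ends at [j.-1], where no partition exists, and the polynomial of [m]
    simply gets multiplied by a [phi]; if [i - j] is even it reaches [j] itself,
    where [fib j] is needed twice, and this produces the correction term in the
    recurrence of [D]. Hence each run of equal parity contributes one factor
    [D], and a change of parity starts a new factor. *)
Require Import Defs.
From mathcomp Require Import all_boot all_order all_algebra.
From mathcomp Require Import zify ring.

Import GRing.Theory.

Local Open Scope ring_scope.

Lemma last2_ind (T : Type) (Q : seq T -> Prop) :
    Q [::] -> (forall x, Q [:: x]) ->
    (forall s x y, Q s -> Q (rcons s x) -> Q (rcons (rcons s x) y)) ->
  forall s, Q s.
Proof.
move=> Q0 Q1 Q2 s; suff [] : Q s /\ forall x, Q (rcons s x) by [].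
by elim/last_ind: s => [|s x [Qs Qsx]]; split=> // y; apply: Q2.
Qed.

Lemma prodr_add1 (R : comPzSemiRingType) (I : finType) (A : {set I})
    (F : I -> R) :
  \prod_(i in A) (1 + F i) =
  \sum_(P : {set I} | P \subset A) \prod_(i in P) F i.
Proof.
pose G i := if i \in A then F i else 0.
have -> : \prod_(i in A) (1 + F i) = \prod_i (G i + 1).
  rewrite big_mkcond; apply: eq_bigr => i _; rewrite /G addrC.
  by case: ifP; rewrite ?add0r.
rewrite bigA_distr [RHS]big_mkcond; apply: eq_bigr => P _.
rewrite -big_mkcond; case: ifPn => [PA|/subsetPn[i iP iA]].
  by apply: eq_bigr => i /(subsetP PA) iA; rewrite /G iA.
by rewrite (bigD1 i) //= /G (negbTE iA) mul0r.
Qed.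

Section SubsetSums.

Variable R : comNzSemiRingType.

Lemma coef_prod_add1ZXn (I : finType) (A : {set I}) (w : I -> nat) (a : R) m :
  (\prod_(i in A) (1 + a *: 'X^(w i)))`_m =
  \sum_(P : {set I} | (P \subset A) && (\sum_(i in P) w i == m)%N) a ^+ #|P|.
Proof.
rewrite prodr_add1 coef_sum big_mkcondr; apply: eq_bigr => P _.
rewrite scaler_prodl prodrXr coefZ coefXn eq_sym.
by case: eqP; rewrite ?mulr1 ?mulr0.
Qed.

Lemma coef_add1ZXnM (a : R) w (p : {poly R}) m :
  ((1 + a *: 'X^w) * p)`_m =
  p`_m + (if (m < w)%N then 0 else a * p`_(m - w)).
Proof.
rewrite mulrDl mul1r -scalerAl coefD coefZ coefXnM.
by case: ifP; rewrite ?mulr0.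
Qed.

Lemma coef_prod_add1ZXn_trunc (I : Type) (r : seq I) (w : I -> nat) (a : R)
    n m : (m <= n)%N ->
  (\prod_(i <- r) (1 + a *: 'X^(w i)))`_m =
  (\prod_(i <- r | (w i <= n)%N) (1 + a *: 'X^(w i)))`_m.
Proof.
elim: r m => [|i r IH] m le_mn; rewrite ?big_nil // !big_cons.
case: leqP => [_|lt_nw]; rewrite !coef_add1ZXnM IH //.
  by rewrite IH // (leq_trans (leq_subr _ _)).
by rewrite (leq_ltn_trans le_mn lt_nw) addr0.
Qed.

End SubsetSums.

Lemma leq_fibS k : (fib k <= fib k.+1)%N.
Proof. by case: k => [|k] //; rewrite fibSS leq_addr. Qed.

Lemma ltn_fibS k : (fib k.+1 < fib k.+2)%N.
Proof. by rewrite fibSS -[X in (X < _)%N]addn0 ltn_add2l fib_gt0. Qed.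

Lemma fib_homo : {homo fib : j k / (j <= k)%N}.
Proof. exact: homo_leq leqnn leq_trans leq_fibS. Qed.

Lemma ltn_fib_add i m : (0 < i)%N -> (m < fib i.-1)%N ->
  (fib i + m < fib i.+1)%N.
Proof. by case: i => // i _; rewrite fibSS ltn_add2l. Qed.

Lemma fib_inj : {in leq 1 &, injective fib}.
Proof.
have fibS_mono := leq_mono (homo_ltn ltn_trans ltn_fibS).
by move=> [|i] [|j] // _ _ /(incn_inj fibS_mono) ->.
Qed.

(** The coefficient of [y^m] in [\prod_(1 <= i <= k) (1 + t y^(fib i))]: the
    scalar ['X] stands for [t], the indeterminate ['X] it scales for [y]. *)
Definition fib_gf_upto (k m : nat) : {poly int} :=
  (\prod_(1 <= i < k.+1) (1 + 'X *: 'X^(fib i)))`_m.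

Lemma fib_gf_upto0 m : fib_gf_upto 0 m = (m == 0%N)%:R.
Proof. by rewrite /fib_gf_upto big_nil coef1. Qed.

Lemma fib_gf_uptoS k m : fib_gf_upto k.+1 m = fib_gf_upto k m +
  (if (m < fib k.+1)%N then 0 else 'X * fib_gf_upto k (m - fib k.+1)).
Proof. by rewrite /fib_gf_upto big_nat_recr //= mulrC coef_add1ZXnM. Qed.

Definition fib_numbers (n : nat) : {set 'I_n.+1} :=
  [set x : 'I_n.+1 | [exists i : 'I_n.+1, (0 < i)%N && (fib i == x)]].

Lemma fib_numbersE n : fib_numbers n =
  [set inord (fib i)
  | i : 'I_n.+1 in [pred i : 'I_n.+1 | (fib i <= n)%N & (0 < i)%N]].
Proof.
apply/setP => x; rewrite inE.
apply/existsP/imsetP => [[i /andP[i_gt0 /eqP ex]]|[i /andP[le_in i_gt0] ->]].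
  by exists i; rewrite ?inE ?ex ?inord_val // i_gt0 -ltnS ltn_ord.
by exists i; rewrite i_gt0 inordK ?eqxx.
Qed.

Lemma big_fib_numbers (R : Type) (idx : R) (op : Monoid.com_law idx) n
    (G : nat -> R) :
  \big[op/idx]_(x in fib_numbers n) G x =
  \big[op/idx]_(1 <= i < n.+1 | (fib i <= n)%N) G (fib i).
Proof.
rewrite fib_numbersE big_imset => [|i j /andP[le_in i_gt0] /andP[le_jn j_gt0]].
  by rewrite big_geq_mkord; apply: eq_bigr => i /andP[le_in _]; rewrite inordK.
move=> /(congr1 val) /=; rewrite !inordK // => /fib_inj eq_ij.
by apply/val_inj/eq_ij.
Qed.

Lemma fib_gf_sum n : fib_gf n = \sum_(P in fib_partitions n) 'X^#|P|.
Proof.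
apply/polyP => h; rewrite coef_fib_gf coef_sum.
rewrite /fib_count -sum1_card natr_sum big_mkcond [RHS]big_mkcond /=.
apply: eq_bigr => P _; rewrite inE coefXn eq_sym.
by case: (_ == _); rewrite ?andbT ?andbF ?if_same.
Qed.

Lemma fib_gfE n : fib_gf n = fib_gf_upto n n.
Proof.
rewrite fib_gf_sum /fib_gf_upto (coef_prod_add1ZXn_trunc _ _ _ _ _ n) //.
rewrite -(big_fib_numbers _ _ _ n (fun x => 1 + 'X *: 'X^x)) coef_prod_add1ZXn.
apply: eq_bigl => P; rewrite inE; congr (_ && _).
by apply/forall_inP/subsetP => PF x /PF; rewrite inE.
Qed.

Lemma fib_gf_upto_eq0 k m : (fib k.+2 <= m)%N -> fib_gf_upto k m = 0.
Proof.
elim: k m => [|k IH] m; first by case: m => // m _; rewrite fib_gf_upto0.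
rewrite fibSS => le_m; have := leq_fibS k.+1 => le_fib.
by rewrite fib_gf_uptoS !IH ?mulr0 ?if_same ?addr0 //; lia.
Qed.

Lemma fib_gf_upto_stable k l m : (m < fib k.+1)%N -> (k <= l)%N ->
  fib_gf_upto l m = fib_gf_upto k m.
Proof.
move=> lt_m; elim: l => [|l IH]; first by rewrite leqn0 => /eqP ->.
rewrite leq_eqVlt => /predU1P[-> //|le_kl].
by rewrite fib_gf_uptoS IH // (leq_trans lt_m) ?addr0 // fib_homo.
Qed.

Lemma fib_gf_uptoE k m : (m < fib k.+1)%N -> fib_gf_upto k m = fib_gf m.
Proof.
move=> lt_m; rewrite fib_gfE -(fib_gf_upto_stable k (maxn k m)) ?leq_maxl //.
by apply: fib_gf_upto_stable; rewrite ?leq_maxr // leq_fib.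
Qed.

Lemma phi0 : phi 0 = 0.
Proof. by rewrite /phi big_geq. Qed.

Lemma phiS k : phi k.+1 = 'X + 'X * phi k.
Proof.
rewrite /phi big_ltn // big_add1 /= mulr_sumr expr1; congr (_ + _).
by apply: eq_bigr => i _; rewrite exprS.
Qed.

Lemma phiSr k : phi k.+1 = phi k + 'X^(k.+1).
Proof. by rewrite /phi big_nat_recr. Qed.

(** Either the part [fib i.+2] occurs, or [fib i.+1] must, since the smaller
    parts add up to less than [fib i.+2]. *)
Lemma fib_gf_upto_top i m : (m < fib i.+2)%N ->
  fib_gf_upto i.+2 (fib i.+2 + m) =
  'X * fib_gf m + 'X * fib_gf_upto i (fib i + m).
Proof.
move=> lt_m; rewrite fib_gf_uptoS ltnNge leq_addr addKn (fib_gf_uptoE _ m) //=.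
have le_fib : (fib i.+1 <= fib i.+2 + m)%N by have := leq_fibS i.+1; lia.
rewrite fib_gf_uptoS ltnNge le_fib fib_gf_upto_eq0 ?leq_addr //= add0r addrC.
by congr (_ + 'X * fib_gf_upto _ _); rewrite fibSS; lia.
Qed.

Lemma fib_gf_upto_descent i k m : (m < fib i.+2)%N ->
  fib_gf_upto (i + k.*2) (fib (i + k.*2) + m) =
  phi k * fib_gf m + 'X^k * fib_gf_upto i (fib i + m).
Proof.
move=> lt_m; elim: k => [|k IH].
  by rewrite double0 addn0 phi0 mul0r add0r mul1r.
rewrite doubleS !addnS fib_gf_upto_top; last first.
  by apply: leq_trans lt_m (fib_homo _ _ _); rewrite !ltnS leq_addr.
by rewrite IH phiS exprS; ring.
Qed.

Lemma fib_gf_descent i k m : (0 < i + k.*2)%N ->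
  (m < fib (i + k.*2).-1)%N -> (m < fib i.+2)%N ->
  fib_gf (fib (i + k.*2) + m) =
  phi k * fib_gf m + 'X^k * fib_gf_upto i (fib i + m).
Proof.
move=> ik_gt0 lt_m lt_mi; rewrite -fib_gf_upto_descent // fib_gf_uptoE //.
exact: ltn_fib_add.
Qed.

Lemma fib_gf0 : fib_gf 0 = 1.
Proof. by rewrite fib_gfE fib_gf_upto0. Qed.

Lemma fib_gf_fib i : (0 < i)%N -> fib_gf (fib i) = phi (i - 1)./2.+1.
Proof.
move=> i_gt0; have ei : i = (odd i + i./2.*2)%N by rewrite odd_double_half.
rewrite {1}ei -[fib _]addn0 fib_gf_descent ?fib_gt0 -?ei // fib_gf0 mulr1.
have [odd_i|even_i] := boolP (odd i).
  have -> : (i - 1)./2 = i./2 by lia.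
  by rewrite fib_gf_uptoS !fib_gf_upto0 add0r mulr1 -exprSr phiSr.
have -> : (i - 1)./2.+1 = i./2 by lia.
by rewrite fib_gf_upto0 mulr0 addr0.
Qed.

(** The descent ends at [fib_gf_upto j (fib j + m) = 0]: the parts up to
    [fib j] add up to less than [fib j.+2 <= fib j + m]. *)
Lemma fib_gf_odd_gap j k m : (1 < k)%N -> (fib j.+1 <= m < fib j.+2)%N ->
  fib_gf (fib (j + k.*2) + m) = phi k * fib_gf m.
Proof.
move=> k_gt1 /andP[le_m lt_m]; rewrite fib_gf_descent //; first last.
- by apply: leq_trans lt_m (fib_homo _ _ _); lia.
- by lia.
by rewrite fib_gf_upto_eq0 ?mulr0 ?addr0 // fibSS addnC leq_add2l.
Qed.

(** The descent ends at [fib_gf_upto j.+1 (2 * fib j.+1 + m)]: the part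
    [fib j.+1] must occur, and the rest is a partition of [fib j.+1 + m] that
    avoids it, whence the subtracted term. *)
Lemma fib_gf_even_gap j k m : (0 < k)%N -> (m < fib j)%N ->
  fib_gf (fib (j.+1 + k.*2) + (fib j.+1 + m)) =
  phi k.+1 * fib_gf (fib j.+1 + m) - 'X^(k.+2) * fib_gf m.
Proof.
move=> k_gt0 lt_m.
have lt_jm : (fib j.+1 + m < fib j.+2)%N by exact: ltn_fib_add.
have gf_avoid : fib_gf_upto j (fib j.+1 + m) =
    fib_gf (fib j.+1 + m) - 'X * fib_gf m.
  rewrite -(fib_gf_uptoE _ _ lt_jm) fib_gf_uptoS ltnNge leq_addr addKn /=.
  by rewrite (fib_gf_uptoE j m) ?addrK // (leq_trans lt_m (leq_fibS _)).
have gf_twice : fib_gf_upto j.+1 (fib j.+1 + (fib j.+1 + m)) =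
    'X * (fib_gf (fib j.+1 + m) - 'X * fib_gf m).
  rewrite fib_gf_uptoS ltnNge leq_addr addKn gf_avoid /=.
  by rewrite fib_gf_upto_eq0 ?add0r // fibSS; have := leq_fibS j; lia.
rewrite fib_gf_descent // ?gf_twice; first by rewrite phiSr !exprS; ring.
  by apply: leq_trans lt_jm (fib_homo _ _ _); lia.
exact: leq_trans lt_jm (leq_fibS _).
Qed.

Definition fib_sum (I : seq nat) : nat := \sum_(i <- I) fib i.

Lemma fib_sum_rcons I i : fib_sum (rcons I i) = (fib i + fib_sum I)%N.
Proof. by rewrite /fib_sum big_rcons addnC. Qed.

Lemma two_partition_rcons_sum_lt I i : two_partition (rcons I i) ->
  (fib_sum I < fib i.-1)%N.
Proof.
rewrite two_partition_rcons => /and3P[i_gt0 Ii I2].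
case: i i_gt0 Ii => [|[|i]] // _ Ii; last exact: two_partition_sum_lt.
by case: I Ii {I2} => // _; rewrite /fib_sum big_nil.
Qed.

Lemma two_partition_rcons2 I j i : two_partition (rcons (rcons I j) i) ->
  [/\ 0 < j, j.+2 <= i & fib_sum I < fib j.-1]%N.
Proof.
rewrite two_partition_rcons all_rcons => /and3P[_ /andP[le_ji _] Ij2].
split=> //; last exact: two_partition_rcons_sum_lt Ij2.
by move: Ij2; rewrite two_partition_rcons => /and3P[].
Qed.

Lemma fib_gf_rcons_odd I j i : two_partition (rcons (rcons I j) i) ->
  odd i != odd j ->
  fib_gf (fib_sum (rcons (rcons I j) i)) =
  phi ((i - j)./2.+1) * fib_gf (fib_sum (rcons I j)).
Proof.
case/two_partition_rcons2; rewrite fib_sum_rcons.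
case: j => // j _ le_ji lt_I odd_ij.
have {1}-> : i = (j + (i - j.+1)./2.+1.*2)%N by lia.
apply: fib_gf_odd_gap; first by lia.
by rewrite fib_sum_rcons leq_addr ltn_fib_add.
Qed.

Lemma fib_gf_rcons_even I j i : two_partition (rcons (rcons I j) i) ->
  odd i = odd j ->
  fib_gf (fib_sum (rcons (rcons I j) i)) =
  phi ((i - j)./2.+1) * fib_gf (fib_sum (rcons I j))
  - 'X^((i - j)./2.+2) * fib_gf (fib_sum I).
Proof.
case/two_partition_rcons2; rewrite !fib_sum_rcons.
case: j => // j _ le_ji lt_I odd_ij.
have {1}-> : i = (j.+1 + (i - j.+1)./2.*2)%N by lia.
by apply: fib_gf_even_gap => //; lia.
Qed.

Lemma two_partition_catl I J : two_partition (I ++ J) -> two_partition I.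
Proof.
by rewrite /two_partition all_cat => /andP[/andP[-> _] /cat_sorted2[-> _]].
Qed.

Definition half_gaps (i : nat) (J : seq nat) : seq nat :=
  pairmap (fun a b => (b - a)./2.+1) i J.

Lemma assoc_vectorE I : assoc_vector I = half_gaps 1 I.
Proof. by case: I. Qed.

Lemma half_gaps_cat i J K :
  half_gaps i (J ++ K) = half_gaps i J ++ half_gaps (last i J) K.
Proof. exact: pairmap_cat. Qed.

Lemma half_gaps_rcons i J j :
  half_gaps i (rcons J j) = rcons (half_gaps i J) ((j - last i J)./2.+1).
Proof. by rewrite -!cats1 half_gaps_cat. Qed.

Definition parity_break (I J : seq nat) : bool :=
  (I != [::]) ==> (odd (last 0%N I) != odd (head 0%N J)).

Lemma fib_gf_rcons_break I i : two_partition (rcons I i) ->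
  parity_break I [:: i] ->
  fib_gf (fib_sum (rcons I i)) =
  phi ((i - last 1%N I)./2.+1) * fib_gf (fib_sum I).
Proof.
rewrite /parity_break; case/lastP: I => [|I j] Ii2.
  have := Ii2; rewrite two_partition_rcons => /andP[i_gt0 _] _.
  by rewrite /fib_sum big_seq1 big_nil fib_gf_fib // fib_gf0 mulr1.
rewrite -size_eq0 size_rcons !last_rcons /= eq_sym; exact: fib_gf_rcons_odd.
Qed.

Lemma fib_gf_cat_same_parity I J : two_partition (I ++ J) ->
  same_parity J -> parity_break I J ->
  fib_gf (fib_sum (I ++ J)) =
  fib_gf (fib_sum I) * D (half_gaps (last 1%N I) J).
Proof.
rewrite /parity_break => IJ2 Jpar.
have: all (fun j => odd j == odd (head 0%N J)) J.
  case: J Jpar {IJ2} => // j J /allP Jpar.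
  by apply/allP => i /Jpar /andP[].
move: (odd (head _ J)) => c {Jpar}.
elim/last2_ind: J IJ2 => [|i|J j i IHJ IHJj].
- by rewrite cats0 D_nil mulr1.
- rewrite /= andbT cats1 => Ii2 /eqP <- Ii.
  by rewrite D_seq1 fib_gf_rcons_break // mulrC.
rewrite -!rcons_cat !all_rcons => IJji2 /and3P[/eqP ic /eqP jc Jc] Ic.
have IJj2 : two_partition (rcons (I ++ J) j).
  by move: IJji2; rewrite two_partition_rcons => /and3P[].
have IJ2 : two_partition (I ++ J).
  by move: IJj2; rewrite two_partition_rcons => /and3P[].
have {}IHJj : fib_gf (fib_sum (rcons (I ++ J) j)) =
    fib_gf (fib_sum I) * D (half_gaps (last 1%N I) (rcons J j)).
  by rewrite rcons_cat IHJj // -?rcons_cat // all_rcons jc eqxx.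
rewrite fib_gf_rcons_even ?ic ?jc // IHJj IHJ //.
by rewrite !half_gaps_rcons D_rcons2 last_rcons; ring.
Qed.

Lemma parity_break_catl I J K : J != [::] ->
  parity_break (I ++ J) K = parity_break J K.
Proof.
case/lastP: J => // J j _.
by rewrite /parity_break -rcons_cat !last_rcons -!size_eq0 !size_rcons.
Qed.

Lemma parity_break_canonical_form I Is : is_canonical_form I Is ->
  path parity_break [::] Is.
Proof.
case=> _ _ _ Is_sorted; suff: sorted parity_break Is by case: (Is).
apply: sub_sorted Is_sorted => J K /andP[lt_JK].
by rewrite oddB ?(ltnW lt_JK) // addbC -negb_eqb => odd_JK; apply/implyP.
Qed.

Lemma fib_gf_cat_flatten P Is : two_partition (P ++ flatten Is) ->
  all (fun J => J != [::]) Is -> all same_parity Is -> path parity_break P Is ->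
  fib_gf (fib_sum (P ++ flatten Is)) = fib_gf (fib_sum P) *
    \prod_(B <- reshape (shape Is) (half_gaps (last 1%N P) (flatten Is))) D B.
Proof.
elim: Is P => [|J Is IH] P /=; first by rewrite cats0 big_nil mulr1.
rewrite catA => PJ2 /andP[J0 Is0] /andP[Jpar Ispar] /andP[PJ JIs].
rewrite half_gaps_cat take_size_cat ?drop_size_cat ?size_pairmap // big_cons.
rewrite {}IH // ?last_cat; last first.
  by case: Is JIs {PJ2 Is0 Ispar} => //= K Is; rewrite parity_break_catl.
rewrite mulrA (fib_gf_cat_same_parity P J) //.
exact: two_partition_catl PJ2.
Qed.

Lemma fib_gf_canonical_form I Is : two_partition I -> is_canonical_form I Is ->
  fib_gf (fib_sum I) = \prod_(B <- reshape (shape Is) (assoc_vector I)) D B.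
Proof.
move=> I2 Ican; have break_Is := parity_break_canonical_form _ _ Ican.
case: Ican => eI Is0 Is_simple _; rewrite -{}eI in I2 *.
rewrite assoc_vectorE (fib_gf_cat_flatten [::]) //.
  by rewrite /fib_sum big_nil fib_gf0 mul1r.
by apply: sub_all Is_simple => J /andP[].
Qed.

Theorem theorem1p4 (n : nat) (n_gt0 : (0 < n)%N) :
  fib_gf n = \prod_(B <- multivector (zeckendorf n)) D B.
Proof.
have /andP[Z2 /eqP {1}<-] := zeckendorfP n.
exact: fib_gf_canonical_form Z2 (canonical_formP Z2).
Qed.
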